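(* In the unidimensional platform game of the context, at the (differentiated) pure-strategy equilibrium and under the contestable-power-weighted implementation rule, $$\widehat V_p-\frac{\nu(1)+\nu(0)}2=\frac{D^2}{2\phi}>0\quad(p=A,B),\qquad \mathrm{Var}(X^\star)=D^2\,\mathrm{Var}(\Lambda)>0,\qquad \mathcal W^\star<\mathcal W(x^o).$$
   Context: There are $N\ge2$ voter types with bliss points $x_1<\cdots<x_N$ in $\mathbb R$ and shares $s_i>0$, $\sum_is_i=1$; type $i$'s utility from policy $x$ is $v(x,x_i)=-(x-x_i)^2$. Parties $A,B$ simultaneously choose platforms in $[x_1,x_N]$. Let $\Delta_i(x_A,x_B)=(x_B-x_i)^2-(x_A-x_i)^2$. A common shock $\epsilon$ is uniform on $[-\phi,\phi]$ with $\phi>\max_{a,b\in[x_1,x_N],\,i}|\Delta_i(a,b)|$. Party $A$'s vote share is $s_A(x_A,x_B,\epsilon)=\sum_is_i\mathbf 1\{\Delta_i(x_A,x_B)\ge\epsilon\}$ and $B$'s is $1-s_A$. The power rule $\rho:[0,1]\to\mathbb R$ is strictly increasing (possibly discontinuous) with $\rho(s)+\rho(1-s)=\bar\rho$ for all $s$; $U:[\rho(0),\rho(1)]\to\mathbb R$ is continuous, strictly increasing, strictly concave; $\nu=U\circ\rho$ with $\nu(1)-\nu(0)=1$. Each party's payoff is the expectation over $\epsilon$ of $\nu$ evaluated at its vote share. Equilibrium: with $\underline s_i=\sum_{j\le i}s_j$, $\bar s_i=\sum_{j\ge i}s_j$, $\underline s_0=\bar s_{N+1}=0$, the pure-strategy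 equilibrium platforms (unique up to party labels) are $\underline x=\sum_i[\nu(\underline s_i)-\nu(\underline s_{i-1})]x_i<\bar x=\sum_i[\nu(\bar s_i)-\nu(\bar s_{i+1})]x_i$. Let $x_A=\bar x$, $x_B=\underline x$, $D=\bar x-\underline x$, and let $\widehat V_p$ be party $p$'s equilibrium payoff. Implementation: $r(s)=\frac{\rho(s)-\rho(0)}{\rho(1)-\rho(0)}$, $\Lambda(\epsilon)=r(s_A(\bar x,\underline x,\epsilon))$, and implemented policy is $X^\star(\epsilon)=\Lambda(\epsilon)\bar x+(1-\Lambda(\epsilon))\underline x=\underline x+\Lambda(\epsilon)D$. Welfare: $\mathcal W(x)=\sum_is_iv(x,x_i)$, $x^o=\sum_is_ix_i$ (its maximizer), $\mathcal W^\star=\mathbb E_\epsilon[\mathcal W(X^\star(\epsilon))]$. Variances are over $\epsilon$. *)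

(* Defs.v *)
From mathcomp Require Import all_boot all_order all_algebra.
From mathcomp Require Import all_classical all_reals all_analysis.
Set Implicit Arguments.
Unset Strict Implicit.
Unset Printing Implicit Defensive.
Import Order.TTheory GRing.Theory Num.Theory.
Import numFieldNormedType.Exports.
Local Open Scope classical_set_scope.
Local Open Scope ring_scope.

(* The N >= 2 voter types are indexed by 'I_n.+2, with N = n.+2: the bliss
   points x_1 and x_N are x ord0 and x ord_max. *)

Section StrictConcavity.
Context {R : realType}.

Definition strictly_increasing_on (D : set R) (f : R -> R) : Prop :=
  forall u v, D u -> D v -> u < v -> f u < f v.

Definition strictly_concave_on (D : set R) (f : R -> R) : Prop :=
  forall u v t, D u -> D v -> u != v -> 0 < t -> t < 1 ->
    t * f u + (1 - t) * f v < f (t * u + (1 - t) * v).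

End StrictConcavity.

Section PlatformGame.
Context {R : realType} {n : nat}.
Implicit Types (x s : 'I_n.+2 -> R) (i : 'I_n.+2) (a b y eps : R).

Definition utility y (xi : R) : R := - (y - xi) ^+ 2.

Definition platforms x : set R := `[x ord0, x ord_max].

(* Type i's utility gain from A's platform a over B's platform b. *)
Definition gap x i a b : R := (b - x i) ^+ 2 - (a - x i) ^+ 2.

Definition voteshareA x s a b eps : R :=
  \sum_i s i * (eps <= gap x i a b)%R%:R.

Definition voteshareB x s a b eps : R := 1 - voteshareA x s a b eps.

Section Payoffs.
Variable P : probability (measurableTypeR R) R.  (* law of the common shock *)
Variables (x s : 'I_n.+2 -> R) (nu : R -> R).

Definition payoffA a b : \bar R :=
  'E_P[fun eps => nu (voteshareA x s a b eps)]%E.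

Definition payoffB a b : \bar R :=
  'E_P[fun eps => nu (voteshareB x s a b eps)]%E.

Definition pure_equilibrium a b : Prop :=
  [/\ platforms x a, platforms x b,
      forall a', platforms x a' -> (payoffA a' b <= payoffA a b)%E &
      forall b', platforms x b' -> (payoffB a b' <= payoffB a b)%E].

End Payoffs.

(* The partial sums of s over j < i and j > i are the cumulative shares at
   indices i - 1 and i + 1, and they vanish at the first and last type. *)
Definition plat_low x s (nu : R -> R) : R :=
  \sum_(i < n.+2) (nu (\sum_(j < n.+2 | (j <= i)%N) s j) -
                    nu (\sum_(j < n.+2 | (j < i)%N) s j)) * x i.

Definition plat_high x s (nu : R -> R) : R :=
  \sum_(i < n.+2) (nu (\sum_(j < n.+2 | (i <= j)%N) s j) -
                    nu (\sum_(j < n.+2 | (i < j)%N) s j)) * x i.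

Definition power_share (rho : R -> R) (t : R) : R :=
  (rho t - rho 0) / (rho 1 - rho 0).

Definition weightA x s (rho : R -> R) a b eps : R :=
  power_share rho (voteshareA x s a b eps).

Definition implemented x s (rho : R -> R) a b eps : R :=
  weightA x s rho a b eps * a + (1 - weightA x s rho a b eps) * b.

Definition welfare x s y : R := \sum_i s i * utility y (x i).

Definition mean_bliss x s : R := \sum_i s i * x i.

End PlatformGame.

(* Main.v *)
Require Import Defs.
From mathcomp Require Import all_boot all_order all_algebra.
From mathcomp Require Import all_classical all_reals all_analysis.
From mathcomp Require Import measurable_realfun ring lra.
Set Implicit Arguments.
Unset Strict Implicit.
Unset Printing Implicit Defensive.
Import Order.TTheory GRing.Theory Num.Theory.
Import numFieldNormedType.Exports.
Local Open Scope classical_set_scope.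
Local Open Scope ring_scope.

(* Against any b, party A's vote share as a function of the shock is a step
   function with steps at the gaps, and the gaps are monotone in the type.
   Telescoping nu over the steps makes A's payoff affine in the gaps, hence
   equal to (nu 1 + nu 0) / 2 + ((b - z)^2 - (a - z)^2) / (2 phi), where the
   weighted mean voter z is xh when A is to the right of B and xl when A is to
   the left; B's payoff is symmetric.  Strict concavity of U and rho(t) + rho(1 - t)
   constant give nu(t) + nu(1 - t) > nu(0) + nu(1) for 0 < t < 1, whence xl < xh
   by Abel summation, and the best replies are elementary.  As all gaps are
   smaller than phi, A wins unanimously and loses unanimously with positive
   probability, so the implemented policy is not almost surely constant, which
   gives the variance and welfare claims. *)

(** * Summation by parts and threshold sets of indices *)

Lemma abel_summation (R : comNzRingType) (m : nat) (H p : nat -> R) :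
  \sum_(i < m.+1) (H i - H i.+1) * p i =
  H 0%N * p 0%N + \sum_(i < m) H i.+1 * (p i.+1 - p i) - H m.+1 * p m.
Proof.
elim: m => [|m IHm]; first by rewrite big_ord1 big_ord0; ring.
by rewrite big_ord_recr /= IHm [in RHS]big_ord_recr /=; ring.
Qed.

Lemma abel_summation_ord (R : comNzRingType) (m : nat) (H : nat -> R)
    (p : 'I_m.+1 -> R) :
  \sum_(i < m.+1) (H i - H i.+1) * p i =
  H 0%N * p ord0 + \sum_(i < m) H i.+1 * (p (lift ord0 i) - p (widen_ord (leqnSn m) i))
  - H m.+1 * p ord_max.
Proof.
have pE (i : 'I_m.+1) : p i = p (inord i) by rewrite inord_val.
under eq_bigr do rewrite pE.
rewrite (abel_summation m H (fun k => p (inord k))) [p ord0]pE [p ord_max]pE.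
congr (_ + _ - _); apply: eq_bigr => i _.
by rewrite [p (lift _ _)]pE [p (widen_ord _ _)]pE.
Qed.

(** The threshold is the least element of [P]; [k = m] encodes the empty predicate. *)
Lemma up_closed_threshold (m : nat) (P : pred 'I_m) :
  (forall i j : 'I_m, (i <= j)%N -> P i -> P j) ->
  exists2 k, (k <= m)%N & forall i : 'I_m, P i = (k <= i)%N.
Proof.
move=> Pup; case: (pickP P) => [i0 Pi0|P0]; last first.
  by exists m => // i; rewrite P0 leqNgt ltn_ord.
case: (arg_minnP (@nat_of_ord m) Pi0) => k Pk kmin; exists k; first exact: ltnW.
by move=> i; apply/idP/idP => [/kmin//|/Pup]; exact.
Qed.

(** * Cumulative shares and telescoping over them *)

Section CumulativeShares.
Context {R : realType} {m : nat}.
Implicit Types (s g w : 'I_m -> R) (h : R -> R).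

(** The index is a natural number so that [m], the empty tail, is allowed. Since [head_share] is
    strict, head and tail at one index are complementary, and the share of types up to and including
    [i] is [head_share s i.+1]. *)
Definition tail_share s (k : nat) : R := \sum_(j < m | (k <= j)%N) s j.
Definition head_share s (k : nat) : R := \sum_(j < m | (j < k)%N) s j.

Lemma head_shareE s k : \sum_i s i = 1 -> head_share s k = 1 - tail_share s k.
Proof.
move=> <-; rewrite (bigID (fun j : 'I_m => (k <= j)%N)) /= addrC addrK.
by apply: eq_bigl => j; rewrite ltnNge.
Qed.

Lemma tail_share0 s : tail_share s 0 = \sum_i s i.
Proof. by []. Qed.

Lemma tail_share_size s : tail_share s m = 0.
Proof. by rewrite /tail_share big1 // => j; rewrite leqNgt ltn_ord. Qed.

Lemma tail_shareS s (i : 'I_m) : tail_share s i = s i + tail_share s i.+1.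
Proof.
rewrite /tail_share (bigD1 i) //=; congr (_ + _).
by apply: eq_bigl => j; rewrite ltn_neqAle andbC eq_sym.
Qed.

Lemma tail_share_le s k l : (forall i, 0 < s i) -> (k <= l)%N ->
  tail_share s l <= tail_share s k.
Proof.
move=> s0 kl; rewrite /tail_share [leRHS](bigID (fun j : 'I_m => (l <= j)%N)) /=.
rewrite -[leLHS]addr0 lerD //; last by apply: sumr_ge0 => j _; exact: ltW.
rewrite le_eqVlt; apply/orP; left; apply/eqP; apply: eq_bigl => j.
by case: (leqP l j); rewrite ?andbF // andbT => /(leq_trans kl) ->.
Qed.

Lemma tail_share_in01 s k : (forall i, 0 < s i) -> \sum_i s i = 1 ->
  0 <= tail_share s k <= 1.
Proof.
move=> s0 s1; rewrite -s1 -tail_share0 tail_share_le // andbT.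
by apply: sumr_ge0 => j _; exact: ltW.
Qed.

(** The sum inside [h] is the tail from the threshold [k], and the increments of [h] from [k] to [m]
    telescope to [h (tail_share s k) - h 0]. A nonlinear function of the vote share thus becomes
    linear in the indicators. *)
Lemma telescope_up_closed h s (P : pred 'I_m) :
  (forall i j : 'I_m, (i <= j)%N -> P i -> P j) ->
  h (\sum_i s i * (P i)%:R) =
  h 0 + \sum_(i < m) (h (tail_share s i) - h (tail_share s i.+1)) * (P i)%:R.
Proof.
move=> /up_closed_threshold[k km PE].
under eq_bigr do rewrite PE mulr_natr mulrb.
under [in RHS]eq_bigr do rewrite PE mulr_natr mulrb.
rewrite -!big_mkcond /= -/(tail_share s k).
transitivity (h 0 +
    \sum_(k <= i < m) (h (tail_share s i) - h (tail_share s i.+1))); last first.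
  by rewrite big_geq_mkord.
under eq_bigr do rewrite -opprB.
by rewrite sumrN telescope_sumr // tail_share_size opprB addrC subrK.
Qed.

Lemma telescope_down_closed h s (P : pred 'I_m) :
  (forall i j : 'I_m, (i <= j)%N -> P j -> P i) ->
  h (\sum_i s i * (P i)%:R) =
  h 0 + \sum_(i < m) (h (head_share s i.+1) - h (head_share s i)) * (P i)%:R.
Proof.
move=> Pdown.
have [i j ij|k km PE] := @up_closed_threshold m (predC P).
  by apply: contra; exact: Pdown.
have {}PE (i : 'I_m) : P i = (i < k)%N by rewrite ltnNge -PE /= negbK.
under eq_bigr do rewrite PE mulr_natr mulrb.
under [in RHS]eq_bigr do rewrite PE mulr_natr mulrb.
rewrite -!big_mkcond /= -/(head_share s k).
rewrite (big_ord_narrow km (F := fun i => h (head_share s i.+1) - h (head_share s i))) /=.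
rewrite -(big_mkord xpredT (fun i => h (head_share s i.+1) - h (head_share s i))).
by rewrite telescope_sumr // {3}/head_share big1 // addrC subrK.
Qed.

End CumulativeShares.

(** * Expectations of step functions of the uniform shock *)

Section UniformShock.
Context {R : realType} (phi : R) (phi_nondeg : - phi < phi).
Local Notation P := (uniform_prob phi_nondeg).

Lemma integral_uniform_ray g : `|g| <= phi ->
  (\int[P]_e (\1_(`]-oo, g]%classic : set R) e)%:E)%E =
  ((g + phi) / (2 * phi))%:E.
Proof.
rewrite ler_norml => /andP[phig gphi].
rewrite integral_uniform //; last exact/measurable_EFinP/measurable_indic.
rewrite integral_indic //=.
have -> : `]-oo, g]%classic `&` `[- phi, phi]%classic = `[- phi, g]%classic.
  apply/seteqP; split => e /=; rewrite !in_itv /=.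
    by case=> eg /andP[-> _].
  by case/andP=> -> eg; rewrite eg (le_trans eg gphi).
have phi0 : 0 < phi by move: phi_nondeg; lra.
(* The length formula separates the degenerate case [g = - phi], where the interval is a point and
   both sides vanish. *)
rewrite lebesgue_measure_itv /= lte_fin; case: ltP => [_|gphi']; last first.
  have -> : g = - phi by lra.
  by rewrite addNr mul0r mule0.
by rewrite -EFinM; congr EFin; field; lra.
Qed.

Lemma expectation_steps m (c : R) (w g : 'I_m -> R) :
  (forall i, `|g i| <= phi) ->
  'E_P[(fun e : R => c + \sum_i w i * (e <= g i)%R%:R)%R]%E =
  (c + \sum_i w i * ((g i + phi) / (2 * phi)))%:E.
Proof.
move=> gphi; rewrite unlock /=.
pose I i : set R := `]-oo, g i]%classic.
have int1 i : P.-integrable setT (fun e => (\1_(I i) e)%:E).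
  apply: integrable_indic => //; exact: measurable_itv.
have intw i : P.-integrable setT (fun e => ((w i)%:E * (\1_(I i) e)%:E)%E).
  exact: integrableZl.
transitivity (\int[P]_e (cst c%:E e + \sum_i ((w i)%:E * (\1_(I i) e)%:E))%E)%E.
  apply: eq_integral => e _; rewrite EFinD; congr (_ + _)%E.
  rewrite -sumEFin; apply: eq_bigr => i _; rewrite -EFinM; congr (_ * _)%:E.
  by rewrite indicE /I mem_setE in_itv.
rewrite integralD //; last 2 first.
- by apply: finite_measure_integrable_cst.
- by apply: integrable_sum.
rewrite integral_cst // [X in (_ * X + _)%E](probability_setT P) mule1 integral_sum // EFinD -sumEFin.
congr (_ + _)%E; apply: eq_bigr => i _.
by rewrite integralZl // integral_uniform_ray.
Qed.

End UniformShock.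

(** Both [r] and its reflection [r0 + r1 - r] are convex combinations of [r0] and [r1], with the
    weights exchanged; the two concavity inequalities are added. *)
Lemma strictly_concave_reflect (R : realType) (U : R -> R) (r0 r1 r : R) :
  strictly_concave_on `[r0, r1] U -> r0 < r -> r < r1 ->
  U r0 + U r1 < U r + U (r0 + r1 - r).
Proof.
move=> Uconc r0r rr1; have r01 := lt_trans r0r rr1.
pose t := (r1 - r) / (r1 - r0).
have t0 : 0 < t by rewrite divr_gt0 ?subr_gt0.
have t1 : t < 1 by rewrite ltr_pdivrMr ?subr_gt0 // mul1r; lra.
have D0 : `[r0, r1]%classic r0 by rewrite /= in_itv /= lexx ltW.
have D1 : `[r0, r1]%classic r1 by rewrite /= in_itv /= lexx ltW.
have r01' : r0 != r1 by rewrite lt_eqF.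
have d0 : r1 - r0 != 0 by rewrite subr_eq0 eq_sym.
have rE : t * r0 + (1 - t) * r1 = r by rewrite /t; field.
have rE' : (1 - t) * r0 + (1 - (1 - t)) * r1 = r0 + r1 - r by rewrite -rE; ring.
have := Uconc _ _ _ D0 D1 r01' t0 t1; rewrite rE => Ur.
have t0' : 0 < 1 - t by rewrite subr_gt0.
have t1' : 1 - t < 1 by rewrite gtrBl.
have := Uconc _ _ _ D0 D1 r01' t0' t1'; rewrite rE' => Ur'.
apply: le_lt_trans (ltrD Ur Ur'); rewrite le_eqVlt; apply/orP; left; apply/eqP.
ring.
Qed.

(** * Best replies in the reduced quadratic game *)

Section Gain.
Context {R : realFieldType}.
Implicit Types (a b xl xh : R).

(* The payoff advantage, in units of 1 / (2 phi), of playing a against b: the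
   platform further to the right is evaluated by the high-weighted mean voter
   xh, the one further to the left by the low-weighted mean voter xl. *)
Definition gain xl xh a b : R :=
  if b <= a then (b - xh) ^+ 2 - (a - xh) ^+ 2
  else (b - xl) ^+ 2 - (a - xl) ^+ 2.

Lemma gain_le xl xh a b : a <= b ->
  gain xl xh a b = (b - xl) ^+ 2 - (a - xl) ^+ 2.
Proof.
by rewrite /gain; case: ltgtP => // -> _; rewrite !subrr.
Qed.

Lemma gain_ge xl xh a b : b <= a ->
  gain xl xh a b = (b - xh) ^+ 2 - (a - xh) ^+ 2.
Proof. by rewrite /gain => ->. Qed.

(** A platform to the left of [xl] has a gain of at most 0; to the right of [xl] the gain is a
    parabola with its peak at [xh]. *)
Lemma gain_best_xh xl xh a : xl < xh -> gain xl xh a xl <= gain xl xh xh xl.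
Proof.
move=> lh; rewrite (gain_ge _ _ (ltW lh)) subrr expr0n subr0.
have [al|la] := leP a xl.
  by rewrite gain_le // subrr expr0n sub0r (le_trans _ (sqr_ge0 _)) // oppr_le0 sqr_ge0.
by rewrite (gain_ge _ _ (ltW la)) gerBl sqr_ge0.
Qed.

Lemma gain_best_xl xl xh b : xl < xh -> gain xl xh b xh <= gain xl xh xl xh.
Proof.
move=> lh; rewrite (gain_le _ _ (ltW lh)) subrr expr0n subr0.
have [bh|hb] := leP b xh.
  by rewrite gain_le // gerBl sqr_ge0.
by rewrite (gain_ge _ _ (ltW hb)) subrr expr0n sub0r (le_trans _ (sqr_ge0 _)) // oppr_le0 sqr_ge0.
Qed.

(** Two kinds of deviation suffice for each party: imitating the opponent, and moving to its own
    peak. *)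
Lemma gain_equilibrium_gt xl xh a b : b < a ->
  gain xl xh b b <= gain xl xh a b -> gain xl xh xh b <= gain xl xh a b ->
  gain xl xh a a <= gain xl xh b a -> gain xl xh xl a <= gain xl xh b a ->
  a = xh /\ b = xl.
Proof.
move=> ba; have ba' := ltW ba.
rewrite !(gain_ge xl xh ba') !(gain_le xl xh ba') !(gain_ge _ _ (lexx _)) !subrr.
move=> Abb Axh Baa Bxl.
(* Imitation yields 0, so [xh] is not below the midpoint of [a] and [b], nor [xl] above it. Hence
   the moves to [xh] and [xl] keep the order of the parties and are evaluated by the same branch of
   [gain]. *)
have bxh : b < xh by nra.
have xla : xl < a by nra.
move: Axh Bxl; rewrite (gain_ge _ _ (ltW bxh)) (gain_le _ _ (ltW xla)) !subrr expr0n !subr0 /=.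
move=> Axh Bxl; split; apply/eqP; rewrite -subr_eq0 -sqrf_eq0 eq_le sqr_ge0 andbT; lra.
Qed.

Lemma gain_equilibrium lo hi xl xh a b :
  lo <= xl -> xl < xh -> xh <= hi -> lo <= a <= hi -> lo <= b <= hi ->
  ((forall a', lo <= a' <= hi -> gain xl xh a' b <= gain xl xh a b) /\
   (forall b', lo <= b' <= hi -> gain xl xh b' a <= gain xl xh b a)) <->
  (a = xh /\ b = xl) \/ (a = xl /\ b = xh).
Proof.
move=> lol lh hhi aI bI.
have lI : lo <= xl <= hi by rewrite lol (le_trans (ltW lh)).
have hI : lo <= xh <= hi by rewrite hhi andbT (le_trans lol) ?ltW.
split=> [[bestA bestB]|[[-> ->]|[-> ->]]]; last 2 first.
- by split=> y _; [exact: gain_best_xh|exact: gain_best_xl].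
- by split=> y _; [exact: gain_best_xl|exact: gain_best_xh].
have [ab|ba|abE] := ltgtP a b.
- right; suff [-> ->] : b = xh /\ a = xl by [].
  apply: (@gain_equilibrium_gt xl xh b a ab);
    by [apply: bestB|apply: bestA].
- by left; apply: (@gain_equilibrium_gt xl xh a b ba);
    by [apply: bestB|apply: bestA].
(* At a common platform the gain is 0. Party A improves strictly by moving to [xh] if [a < xh], and
   otherwise to [xl], which is then below [a]. *)
- subst b; exfalso; have [ah|ha] := ltP a xh.
    have := bestA _ hI; rewrite (gain_ge _ _ (ltW ah)) gain_ge // !subrr expr0n subr0 /=.
    by rewrite leNgt exprn_even_gt0 //= subr_eq0 (lt_eqF ah).
  have la : xl < a := lt_le_trans lh ha.
  have := bestA _ lI; rewrite (gain_le _ _ (ltW la)) gain_le // !subrr expr0n subr0 /=.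
  by rewrite leNgt exprn_even_gt0 //= subr_eq0 (gt_eqF la).
Qed.

End Gain.

(** * Weighted means of bliss points and of gaps *)

Section WeightedMean.
Context {R : realFieldType} {m : nat}.
Implicit Types (w x : 'I_m.+1 -> R).

Lemma weighted_mean_in w x lo hi : (forall i, 0 <= w i) -> \sum_i w i = 1 ->
  (forall i, lo <= x i <= hi) -> lo <= \sum_i w i * x i <= hi.
Proof.
move=> w0 w1 xI; rewrite -[lo]mul1r -[hi]mul1r -w1 !mulr_suml.
by apply/andP; split; apply: ler_sum => i _; rewrite ler_wpM2l //;
  case/andP: (xI i).
Qed.

End WeightedMean.

Section Gap.
Context {R : realType} {n : nat}.
Implicit Types (x w : 'I_n.+2 -> R) (a b phi : R).

(** The gap is affine in the bliss point with slope [2 * (a - b)], so the order of the platforms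
    decides whether A's supporters form an upper or a lower set of types. *)
Lemma gap_diff x i j a b :
  gap x j a b - gap x i a b = 2 * (a - b) * (x j - x i).
Proof. by rewrite /gap; ring. Qed.

(** The squares of the bliss points cancel in each gap, so only the weighted mean of [x]
    survives. *)
Lemma weighted_gap x w a b phi : phi != 0 -> \sum_i w i = 1 ->
  \sum_i w i * ((gap x i a b + phi) / (2 * phi)) =
  2^-1 + ((b - \sum_i w i * x i) ^+ 2 - (a - \sum_i w i * x i) ^+ 2) / (2 * phi).
Proof.
move=> phi0 w1.
transitivity (\sum_i (w i * ((b ^+ 2 - a ^+ 2 + phi) / (2 * phi)) +
    (w i * x i) * ((a - b) / phi))).
  by apply: eq_bigr => i _; rewrite /gap; field.
by rewrite big_split /= -!mulr_suml w1; field.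
Qed.

End Gap.

(** * Properties of [nu] inherited from [rho] and [U] *)

Section PowerUtility.
Context {R : realType} (rho U : R -> R) (rhobar : R).
Hypothesis rho_incr : strictly_increasing_on `[0, 1] rho.
Hypothesis rho_sym : forall t, `[0, 1]%classic t -> rho t + rho (1 - t) = rhobar.
Hypothesis U_incr : strictly_increasing_on `[rho 0, rho 1] U.
Hypothesis U_conc : strictly_concave_on `[rho 0, rho 1] U.

Let rho_le u v : 0 <= u -> u <= v -> v <= 1 -> rho u <= rho v.
Proof.
move=> u0; rewrite le_eqVlt => /predU1P[->//|uv] v1.
by apply/ltW/rho_incr => //=; rewrite in_itv /= ?u0 ?v1 ?(le_trans u0 (ltW uv)) ?(le_trans (ltW uv) v1).
Qed.

Lemma power_utility_incr : strictly_increasing_on `[0, 1] (U \o rho).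
Proof.
move=> u v /[dup] uI + /[dup] vI + uv; rewrite /= !in_itv /= => /andP[u0 u1] /andP[v0 v1].
by apply: U_incr; rewrite /= ?in_itv /= ?rho_le //; exact: rho_incr.
Qed.

(** By [rho_sym], [rho (1 - t)] is the reflection of [rho t] in the interval from [rho 0] to
    [rho 1]. *)
Lemma power_utility_reflect t : 0 < t -> t < 1 ->
  (U \o rho) 0 + (U \o rho) 1 < (U \o rho) t + (U \o rho) (1 - t).
Proof.
move=> t0 t1 /=.
have I0 : `[0, 1]%classic (0 : R) by rewrite /= in_itv /= lexx ler01.
have I1 : `[0, 1]%classic (1 : R) by rewrite /= in_itv /= lexx ler01.
have It : `[0, 1]%classic t by rewrite /= in_itv /= !ltW.
have -> : rho (1 - t) = rho 0 + rho 1 - rho t.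
  by move: (rho_sym It) (rho_sym I0); rewrite subr0; lra.
by apply: strictly_concave_reflect => //; exact: rho_incr.
Qed.

End PowerUtility.

(** * Expectations of functions of the vote share *)

Section ShareExpectation.
Context {R : realType} {m : nat} (phi : R) (phi_nondeg : - phi < phi).
Local Notation P := (uniform_prob phi_nondeg).
Variables (s g : 'I_m.+1 -> R).
Implicit Types (h : R -> R).
Hypothesis g_phi : forall i, `|g i| < phi.

Definition share (e : R) : R := \sum_i s i * (e <= g i)%R%:R.

(** The distribution function of the shock on [[- phi, phi]], where all gaps lie. *)
Definition shock_cdf (y : R) : R := (y + phi) / (2 * phi).

Lemma expectation_share_down h :
  (forall i j : 'I_m.+1, (i <= j)%N -> g j <= g i) ->
  'E_P[h \o share]%E =
  (h 0 + \sum_(i < m.+1) (h (head_share s i.+1) - h (head_share s i)) *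
           shock_cdf (g i))%:E.
Proof.
move=> gdown; rewrite -expectation_steps; last by move=> i; exact: ltW.
congr expectation; apply/funext => e /=; apply: telescope_down_closed => i j ij eg.
exact: le_trans eg (gdown _ _ ij).
Qed.

Hypothesis g_up : forall i j : 'I_m.+1, (i <= j)%N -> g i <= g j.

(** A closed form of the expectation for increasing gaps, which turns moments into finite real
    sums. *)
Definition mean_up h : R :=
  h 0 + \sum_(i < m.+1) (h (tail_share s i) - h (tail_share s i.+1)) *
          shock_cdf (g i).

Lemma expectation_share_up h : 'E_P[h \o share]%E = (mean_up h)%:E.
Proof.
rewrite -expectation_steps; last by move=> i; exact: ltW.
congr expectation; apply/funext => e /=; apply: telescope_up_closed => i j ij eg.
exact: le_trans eg (g_up ij).
Qed.

Lemma mean_up_affine h c d :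
  mean_up (fun t => c * h t + d) = c * mean_up h + d.
Proof.
rewrite /mean_up mulrDr mulr_sumr addrAC; congr (_ + _ + _).
by apply: eq_bigr => i _; ring.
Qed.

Hypothesis s_gt0 : forall i, 0 < s i.
Hypothesis s_sum1 : \sum_i s i = 1.

Lemma mean_up_gt0 h : (forall t, 0 <= h t) -> 0 < h 0 + h 1 -> 0 < mean_up h.
Proof.
move=> h0 h01; have phi0 : 0 < phi by move: phi_nondeg; lra.
have cdf01 i : 0 < shock_cdf (g i) < 1.
  have := g_phi i; rewrite ltr_norml => /andP[pg gp].
  rewrite /shock_cdf divr_gt0 ?ltr_pdivrMr ?mulr_gt0 //=; lra.
(* Summation by parts recovers the law of the vote share: share 1 has probability
   [shock_cdf (g ord0)], share 0 has [1 - shock_cdf (g ord_max)], and both are positive because the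
   gaps are strictly inside the support. *)
rewrite /mean_up (abel_summation_ord (fun k => h (tail_share s k))
  (fun i => shock_cdf (g i))) tail_share0 s_sum1 tail_share_size.
have sum0 : 0 <= \sum_(i < m) h (tail_share s i.+1) *
    (shock_cdf (g (lift ord0 i)) - shock_cdf (g (widen_ord (leqnSn m) i))).
  apply: sumr_ge0 => i _; rewrite mulr_ge0 // subr_ge0 /shock_cdf.
  rewrite ler_pM2r ?invr_gt0 ?mulr_gt0 // lerD2r g_up //=.
have /andP[p0 _] := cdf01 ord0; have /andP[_ pm] := cdf01 ord_max.
have h0pm : 0 <= h 0 * (1 - shock_cdf (g ord_max)).
  by rewrite mulr_ge0 // subr_ge0 ltW.
have h1p0 : 0 <= h 1 * shock_cdf (g ord0) by rewrite mulr_ge0 // ltW.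
have [h1|h1] := ltP 0 (h 1).
  have : 0 < h 1 * shock_cdf (g ord0) by rewrite mulr_gt0.
  lra.
have : 0 < h 0 * (1 - shock_cdf (g ord_max)) by rewrite mulr_gt0 ?subr_gt0 //; lra.
lra.
Qed.

End ShareExpectation.

(** * Payoffs, equilibria and welfare of the platform game *)

Section Game.
Context {R : realType} {n : nat} (x s : 'I_n.+2 -> R).
Hypothesis x_incr : forall i j : 'I_n.+2, (i < j)%N -> x i < x j.
Hypothesis s_gt0 : forall i, 0 < s i.
Hypothesis s_sum1 : \sum_i s i = 1.

Lemma bliss_le (i j : 'I_n.+2) : (i <= j)%N -> x i <= x j.
Proof.
by rewrite leq_eqVlt => /predU1P[/val_inj->//|/x_incr/ltW].
Qed.

Lemma gap_up a b (i j : 'I_n.+2) : b <= a -> (i <= j)%N ->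
  gap x i a b <= gap x j a b.
Proof.
move=> ba ij; rewrite -subr_ge0 gap_diff mulr_ge0 ?subr_ge0 ?bliss_le //.
by rewrite mulr_ge0 // subr_ge0.
Qed.

Lemma gap_down a b (i j : 'I_n.+2) : a <= b -> (i <= j)%N ->
  gap x j a b <= gap x i a b.
Proof.
move=> ab ij; rewrite -subr_le0 gap_diff mulr_le0_ge0 ?subr_ge0 ?bliss_le //.
by rewrite mulr_ge0_le0 // subr_le0.
Qed.

Section Weights.
Variable nu : R -> R.
Hypothesis nu_incr : strictly_increasing_on `[0, 1] nu.
Hypothesis nu_norm : nu 1 - nu 0 = 1.
Hypothesis nu_reflect : forall t, 0 < t -> t < 1 -> nu 0 + nu 1 < nu t + nu (1 - t).

Definition high_weight (i : 'I_n.+2) := nu (tail_share s i) - nu (tail_share s i.+1).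
Definition low_weight (i : 'I_n.+2) := nu (head_share s i.+1) - nu (head_share s i).

Lemma low_weightE i :
  low_weight i = nu (1 - tail_share s i.+1) - nu (1 - tail_share s i).
Proof. by rewrite /low_weight !head_shareE. Qed.

Let tail_in k : `[0, 1]%classic (tail_share s k).
Proof. by rewrite /= in_itv tail_share_in01. Qed.

Let tail_in' k : `[0, 1]%classic (1 - tail_share s k).
Proof. by have := tail_in k; rewrite /= !in_itv /= => /andP[]; lra. Qed.

Lemma tail_shareS_lt (i : 'I_n.+2) : tail_share s i.+1 < tail_share s i.
Proof. by rewrite tail_shareS ltrDr. Qed.

Lemma high_weight_ge0 i : 0 <= high_weight i.
Proof. by rewrite subr_ge0 ltW // nu_incr // tail_shareS_lt. Qed.

Lemma low_weight_ge0 i : 0 <= low_weight i.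
Proof.
by rewrite low_weightE subr_ge0 ltW // nu_incr // ltrD2l ltrN2 tail_shareS_lt.
Qed.

Lemma high_weight_sum : \sum_i high_weight i = 1.
Proof.
have -> : \sum_i high_weight i =
    - \sum_(0 <= k < n.+2) (nu (tail_share s k.+1) - nu (tail_share s k)).
  by rewrite big_mkord -sumrN; apply: eq_bigr => i _; rewrite opprB.
by rewrite telescope_sumr // tail_share0 s_sum1 tail_share_size opprB.
Qed.

Lemma low_weight_sum : \sum_i low_weight i = 1.
Proof.
under eq_bigr do rewrite low_weightE.
rewrite -(big_mkord xpredT (fun k => nu (1 - tail_share s k.+1) - nu (1 - tail_share s k))).
by rewrite telescope_sumr // tail_share0 s_sum1 tail_share_size subrr subr0.
Qed.

Local Notation xh := (plat_high x s nu).
Local Notation xl := (plat_low x s nu).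

Lemma plat_highE : xh = \sum_i high_weight i * x i. Proof. by []. Qed.
(** By computation: [j < i.+1] reduces to [j <= i]. *)
Lemma plat_lowE : xl = \sum_i low_weight i * x i. Proof. by []. Qed.

Let bliss_in i : x ord0 <= x i <= x ord_max.
Proof. by rewrite !bliss_le // -ltnS. Qed.

Lemma plat_high_in : x ord0 <= xh <= x ord_max.
Proof.
exact: (weighted_mean_in high_weight_ge0 high_weight_sum bliss_in).
Qed.

Lemma plat_low_in : x ord0 <= xl <= x ord_max.
Proof.
exact: (weighted_mean_in low_weight_ge0 low_weight_sum bliss_in).
Qed.

Lemma plat_low_lt_high : xl < xh.
Proof.
(* [K] is the excess in [nu_reflect] at the tail share. It vanishes at both ends and is positive
   between them, and the high weight minus the low weight of type [i] is [K i - K i.+1]. *)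
pose K k := nu (tail_share s k) + nu (1 - tail_share s k) - (nu 0 + nu 1).
have K0 : K 0%N = 0 by rewrite /K tail_share0 s_sum1 subrr; ring.
have Km : K n.+2 = 0 by rewrite /K tail_share_size subr0; ring.
have -> : xh = xl + \sum_(i < n.+2) (K i - K i.+1) * x i.
  rewrite plat_highE plat_lowE -big_split /=; apply: eq_bigr => i _.
  by rewrite low_weightE /high_weight /K; ring.
rewrite ltrDl abel_summation_ord K0 Km !mul0r subr0 add0r.
have dx (i : 'I_n.+1) : 0 < x (lift ord0 i) - x (widen_ord (leqnSn n.+1) i).
  by rewrite subr_gt0; apply: x_incr => /=; exact: leqnn.
have Kpos (i : 'I_n.+1) : 0 < K i.+1.
  rewrite subr_gt0; apply: nu_reflect.
    by rewrite (tail_shareS s (lift ord0 i)) ltr_pwDl // (andP (tail_share_in01 _ _ _)).1.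
  apply: (lt_le_trans (tail_shareS_lt (widen_ord (leqnSn n.+1) i))).
  by have /andP[] := tail_share_in01 i s_gt0 s_sum1.
(* There are at least two types, so a first term exists and makes the sum strictly positive. *)
rewrite big_ord_recl ltr_pwDl ?mulr_gt0 //; apply: sumr_ge0 => i _.
by rewrite ltW // mulr_gt0.
Qed.

Variables (phi : R) (phi_nondeg : - phi < phi).
Hypothesis phi_large : forall a b i, platforms x a -> platforms x b ->
  `|gap x i a b| < phi.
Local Notation P := (uniform_prob phi_nondeg).
Local Notation mid := ((nu 1 + nu 0) / 2).

Let phi_neq0 : phi != 0.
Proof. by apply/eqP => p0; move: phi_nondeg; rewrite p0 oppr0 ltxx. Qed.

Lemma payoffA_gain a b : platforms x a -> platforms x b ->
  payoffA P x s nu a b = (mid + gain xl xh a b / (2 * phi))%:E.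
Proof.
move=> aI bI; have gphi i := phi_large i aI bI.
have [ab|ba] := leP a b.
  rewrite gain_le //.
  rewrite [LHS](expectation_share_down phi_nondeg s gphi nu) => [|i j]; last exact: gap_down.
  rewrite (weighted_gap x a b phi_neq0 low_weight_sum) plat_lowE.
  by congr EFin; move: nu_norm; lra.
rewrite gain_ge ?ltW //.
rewrite [LHS](@expectation_share_up _ _ _ phi_nondeg s _ gphi) => [|i j]; last exact/gap_up/ltW.
rewrite /mean_up (weighted_gap x a b phi_neq0 high_weight_sum) plat_highE.
by congr EFin; move: nu_norm; lra.
Qed.

(** The share formulas are applied to [nu (1 - t)], whose increments are the negated weights of the
    other family: high weights when A is on the left, low weights when A is on the right. *)
Lemma payoffB_gain a b : platforms x a -> platforms x b ->
  payoffB P x s nu a b = (mid + gain xl xh b a / (2 * phi))%:E.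
Proof.
move=> aI bI; have gphi i := phi_large i aI bI.
have [ab|ba] := leP a b.
  rewrite gain_ge //.
  rewrite [LHS](expectation_share_down phi_nondeg s gphi (fun t => nu (1 - t)))
    => [|i j]; last exact: gap_down.
  rewrite subr0; under eq_bigr => i _.
    rewrite -opprB mulNr !head_shareE // !subKr. over.
  rewrite sumrN (weighted_gap x a b phi_neq0 high_weight_sum) plat_highE.
  by congr EFin; move: nu_norm; lra.
rewrite gain_le ?ltW //.
rewrite [LHS](@expectation_share_up _ _ _ phi_nondeg s _ gphi _ (fun t => nu (1 - t)))
  => [|i j]; last exact/gap_up/ltW.
rewrite /mean_up subr0; under eq_bigr => i _.
  rewrite -opprB mulNr -low_weightE. over.
rewrite sumrN (weighted_gap x a b phi_neq0 low_weight_sum) plat_lowE.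
by congr EFin; move: nu_norm; lra.
Qed.

Lemma pure_equilibriumE a b : pure_equilibrium P x s nu a b <->
  (a = xh /\ b = xl) \/ (a = xl /\ b = xh).
Proof.
have phi0 : 0 < 2 * phi by move: phi_nondeg; lra.
have platP y : platforms x y = (x ord0 <= y <= x ord_max) by rewrite /platforms /= in_itv.
have /andP[lol lhi] := plat_low_in; have /andP[loh hhi] := plat_high_in.
have le_gain c d : (mid + c / (2 * phi) <= mid + d / (2 * phi)) = (c <= d).
  by rewrite lerD2l ler_pM2r // invr_gt0.
split=> [[aI bI bestA bestB]|abE].
  rewrite platP in aI; rewrite platP in bI.
  apply/(gain_equilibrium lol plat_low_lt_high hhi aI bI); split=> y yI.
    have := bestA y; rewrite !payoffA_gain ?platP // lee_fin le_gain; exact.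
  have := bestB y; rewrite !payoffB_gain ?platP // lee_fin le_gain; exact.
have [aI bI] : x ord0 <= a <= x ord_max /\ x ord0 <= b <= x ord_max.
  by case: abE => -[-> ->]; rewrite plat_low_in plat_high_in.
have [bestA bestB] := (gain_equilibrium lol plat_low_lt_high hhi aI bI).2 abE.
split; rewrite ?platP // => y; rewrite platP => yI.
  by rewrite !payoffA_gain ?platP // lee_fin le_gain bestA.
by rewrite !payoffB_gain ?platP // lee_fin le_gain bestB.
Qed.

End Weights.

(** As the shares sum to 1, completing the square at the mean bliss point leaves the squared
    distance to it as the whole welfare loss. *)
Lemma welfareE y :
  welfare x s y = welfare x s (mean_bliss x s) - (y - mean_bliss x s) ^+ 2.
Proof.
have wE z : welfare x s z =
    - z ^+ 2 + 2 * z * mean_bliss x s - \sum_i s i * x i ^+ 2.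
  have -> : z ^+ 2 = \sum_i s i * z ^+ 2 by rewrite -mulr_suml s_sum1 mul1r.
  rewrite /mean_bliss mulr_sumr -!sumrN -!big_split /=.
  by apply: eq_bigr => i _; rewrite /utility; ring.
by rewrite !wE; ring.
Qed.

End Game.

Theorem mainTheorem19 (R : realType) (n : nat)
  (x s : 'I_n.+2 -> R) (phi : R) (rho U : R -> R) (rhobar : R)
  (x_incr : forall i j : 'I_n.+2, (i < j)%N -> x i < x j)
  (s_gt0 : forall i, 0 < s i)
  (s_sum1 : \sum_i s i = 1)
  (phi_nondeg : - phi < phi)
  (phi_large : forall a b i, platforms x a -> platforms x b ->
     `|gap x i a b| < phi)
  (rho_incr : strictly_increasing_on `[0, 1] rho)
  (rho_sym : forall t, `[0, 1]%classic t -> rho t + rho (1 - t) = rhobar)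
  (U_cont : {within `[rho 0, rho 1], continuous U})
  (U_incr : strictly_increasing_on `[rho 0, rho 1] U)
  (U_conc : strictly_concave_on `[rho 0, rho 1] U)
  (nu_norm : U (rho 1) - U (rho 0) = 1) :
  let nu := U \o rho in
  let P := uniform_prob phi_nondeg in
  let xh := plat_high x s nu in
  let xl := plat_low x s nu in
  let D := xh - xl in
  let VA := payoffA P x s nu xh xl in
  let VB := payoffB P x s nu xh xl in
  let Lam := weightA x s rho xh xl in
  let Xstar := implemented x s rho xh xl in
  let Wstar := 'E_P[welfare x s \o Xstar]%E in
  [/\ (forall a b, pure_equilibrium P x s nu a b <->
         (a = xh /\ b = xl) \/ (a = xl /\ b = xh)) /\ xl < xh,
      (VA - ((nu 1 + nu 0) / 2)%:E = (D ^+ 2 / (2 * phi))%:E)%E /\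
      (VB - ((nu 1 + nu 0) / 2)%:E = (D ^+ 2 / (2 * phi))%:E)%E,
      0 < D ^+ 2 / (2 * phi),
      ('V_P[Xstar] = (D ^+ 2)%:E * 'V_P[Lam] /\
       0 < (D ^+ 2)%:E * 'V_P[Lam])%E &
      (Wstar < (welfare x s (mean_bliss x s))%:E)%E].
Proof.
move=> nu P xh xl D VA VB Lam Xstar Wstar.
have nu_incr : strictly_increasing_on `[0, 1] nu := power_utility_incr rho_incr U_incr.
have nu_reflect : forall t, 0 < t -> t < 1 -> nu 0 + nu 1 < nu t + nu (1 - t) :=
  power_utility_reflect rho_incr rho_sym U_conc.
have lh : xl < xh := plat_low_lt_high x_incr s_gt0 s_sum1 nu_reflect.
have phi0 : 0 < 2 * phi by lra.
have D0 : 0 < D by rewrite subr_gt0.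
have hI : platforms x xh by rewrite /platforms /= in_itv /= plat_high_in.
have lI : platforms x xl by rewrite /platforms /= in_itv /= plat_low_in.
have gphi i := phi_large xh xl i hI lI.
have gup (i j : 'I_n.+2) : (i <= j)%N -> gap x i xh xl <= gap x j xh xl.
  by apply: gap_up => //; exact: ltW.
have Eshare h := expectation_share_up phi_nondeg s gphi gup h.
pose E h := mean_up phi s (fun i => gap x i xh xl) h.
pose L t := power_share rho t.
have E_gt0 h : (forall t, 0 <= h t) -> 0 < h 0 + h 1 -> 0 < E h.
  exact: mean_up_gt0.
have I0 : `[0, 1]%classic (0 : R) by rewrite /= in_itv /= lexx ler01.
have I1 : `[0, 1]%classic (1 : R) by rewrite /= in_itv /= lexx ler01.
have rho01 : rho 0 < rho 1 by apply: rho_incr.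
have L0 : L 0 = 0 by rewrite /L /power_share subrr mul0r.
have L1 : L 1 = 1 by rewrite /L /power_share divff // subr_eq0 gt_eqF.
pose X t := D * L t + xl.
have LamE : Lam = L \o share s (fun i => gap x i xh xl) by [].
have XstarE : Xstar = X \o share s (fun i => gap x i xh xl).
  by apply/funext => e; rewrite /Xstar /implemented /X /D /= -/(Lam e) LamE /=; ring.
(* No constant equals both [h 0] and [h 1], and both unanimous outcomes have positive probability.
   With [c] the mean this gives positive variance; with [c] the mean bliss point, the welfare
   loss. *)
have spread (c : R) (h : R -> R) : h 0 != h 1 -> 0 < E (fun t => (h t - c) ^+ 2).
  move=> h01; apply: E_gt0 => [t|]; first exact: sqr_ge0.
  rewrite lt0r addr_ge0 ?sqr_ge0 // andbT paddr_eq0 ?sqr_ge0 //.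
  rewrite !sqrf_eq0 !subr_eq0; apply: contra h01 => /andP[/eqP-> /eqP->]//.
have varE h : 'V_P[h \o share s (fun i => gap x i xh xl)] =
    (E (fun t => (h t - E h) ^+ 2))%:E.
  rewrite /variance covariance.unlock (Eshare h).
  rewrite -(Eshare (fun t => (h t - E h) ^+ 2)); congr expectation.
have X01 : X 0 != X 1.
  by rewrite /X L0 L1 mulr0 mulr1 add0r -subr_eq0 opprD addrCA subrr addr0 oppr_eq0 gt_eqF.
have gainE : gain xl xh xh xl = D ^+ 2.
  by rewrite gain_ge ?ltW // subrr expr0n subr0 -sqrrN opprB.
have gainE' : gain xl xh xl xh = D ^+ 2.
  by rewrite gain_le ?ltW // subrr expr0n subr0.
split.
- by split=> // a b; exact: pure_equilibriumE.
- rewrite /VA /VB payoffA_gain // payoffB_gain // gainE gainE' -!EFinB.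
  by split; congr EFin; rewrite addrAC subrr add0r.
- by rewrite divr_gt0 // exprn_gt0.
- rewrite LamE XstarE !varE -EFinM; split; last first.
    by rewrite lte_fin mulr_gt0 ?exprn_gt0 // spread // L0 L1 eq_sym oner_eq0.
  congr EFin; rewrite /E mean_up_affine -/(E L).
  (* The added 0 is the constant term needed to read [mean_up_affine] backwards and move [D ^+ 2]
     inside the mean. *)
  rewrite -[RHS]addr0 -[RHS]mean_up_affine; congr mean_up; apply/funext => t.
  by rewrite /X; ring.
- rewrite /Wstar XstarE.
  rewrite (Eshare (welfare x s \o X)) lte_fin.
  pose o := mean_bliss x s.
  have -> : welfare x s \o X = fun t => -1 * (X t - o) ^+ 2 + welfare x s o.
    by apply/funext => t; rewrite /= welfareE // -/o; ring.
  by rewrite mean_up_affine mulN1r gtrDr oppr_lt0 spread.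
Qed.
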